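(* Let $M$ be the $\mathbb{T}$-module of all functions $u(x)=\mathbf{e_1}u_{\widehat 1}(x)+\mathbf{e_2}u_{\widehat 2}(x)$ of a real variable $x$, where $u_{\widehat 1},u_{\widehat 2}\in L^2(\mathbb{R})$ (with values in $\mathbb{C}(\mathbf{i_1})$), equipped with $$(u,v)=\int_{-\infty}^{\infty}u^{\dagger_3}(x)v(x)\,dx=\int_{-\infty}^{\infty}\left[\mathbf{e_1}\bar u_{\widehat 1}(x)v_{\widehat 1}(x)+\mathbf{e_2}\bar u_{\widehat 2}(x)v_{\widehat 2}(x)\right]dx .$$ Then $M$ is a bicomplex Hilbert space.
   Context: Bicomplex numbers: $\mathbb{T}=\{z_1+z_2\mathbf{i_2} : z_1,z_2\in\mathbb{C}(\mathbf{i_1})\}$ with $\mathbb{C}(\mathbf{i_1})=\{x+y\mathbf{i_1}: x,y\in\mathbb{R}\}$, $\mathbf{i_1}^2=\mathbf{i_2}^2=-1$, $\mathbf{j}=\mathbf{i_1}\mathbf{i_2}=\mathbf{i_2}\mathbf{i_1}$, $\mathbf{j}^2=1$; this is a commutative ring. Put $\mathbf{e_1}=(1+\mathbf{j})/2$, $\mathbf{e_2}=(1-\mathbf{j})/2$, so $\mathbf{e_1}+\mathbf{e_2}=1$, $\mathbf{e_1}\mathbf{e_2}=0$, $\mathbf{e_k}^2=\mathbf{e_k}$. Each $w\in\mathbb{T}$ is uniquely $w=z_{\widehat 1}\mathbf{e_1}+z_{\widehat 2}\mathbf{e_2}$ with $z_{\widehat k}\in\mathbb{C}(\mathbf{i_1})$;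 put $P_k(w)=z_{\widehat k}$ and $w^{\dagger_3}=\bar z_{\widehat 1}\mathbf{e_1}+\bar z_{\widehat 2}\mathbf{e_2}$ (bar = complex conjugation in $\mathbb{C}(\mathbf{i_1})$). Let $\mathbb{D}^+=\{x_{\widehat 1}\mathbf{e_1}+x_{\widehat 2}\mathbf{e_2}: x_{\widehat 1},x_{\widehat 2}\in\mathbb{R},\ x_{\widehat 1},x_{\widehat 2}\ge 0\}$. A bicomplex scalar product on a $\mathbb{T}$-module $M$ is a map $(\cdot,\cdot):M\times M\to\mathbb{T}$ such that for all $\psi,\phi,\chi\in M$, $\alpha\in\mathbb{T}$: (1) $(\psi,\phi+\chi)=(\psi,\phi)+(\psi,\chi)$; (2) $(\psi,\alpha\phi)=\alpha(\psi,\phi)$; (3) $(\psi,\phi)=(\phi,\psi)^{\dagger_3}$; (4) $(\psi,\psi)=0\Leftrightarrow\psi=0$. It is always required to be hyperbolic positive, i.e. $(\psi,\psi)\in\mathbb{D}^+$ for all $\psi\in M$. Then $\{M,(\cdot,\cdot)\}$ is called a $\mathbb{T}$-inner product space. Write $(\cdot,\cdot)_{\widehat k}=P_k((\cdot,\cdot))$. The induced $\mathbb{T}$-norm is $\|\phi\|=\frac{1}{\sqrt2}\sqrt{(\mathbf{e_1}\phi,\mathbf{e_1}\phi)_{\widehat 1}+(\mathbf{e_2}\phi,\mathbf{e_2}\phi)_{\widehat 2}}$. A bicomplex Hilbert space is a $\mathbb{T}$-inner product space that is complete with respect to $\|\cdot\|$. As usual, elements of $L^2(\mathbb{R})$ are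 identified when equal almost everywhere. *)

(* Defs.v *)
From HB Require Import structures.
From mathcomp Require Import all_boot all_order all_algebra.
From mathcomp Require Import ring lra.
From mathcomp Require Import all_classical all_reals all_analysis measurable_realfun.
From mathcomp Require Import complex.

Set Implicit Arguments.
Unset Strict Implicit.
Unset Printing Implicit Defensive.

Import Order.TTheory GRing.Theory Num.Theory.
Import numFieldNormedType.Exports.
Import ComplexField.

Local Open Scope classical_set_scope.
Local Open Scope ring_scope.
Local Open Scope complex_scope.
Local Open Scope quotient_scope.

Local Notation Re := complex.Re.
Local Notation Im := complex.Im.

(* C(i1) is R[i]; the bicomplex number z1 + z2 i2 is the pair z1 +i* z2 of the
   complexification of R[i], whose imaginary unit is i2. *)
Definition bicomplex (R : realType) : Type := R[i][i].

HB.instance Definition _ (R : realType) :=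
  GRing.ComNzRing.copy (bicomplex R) (R[i][i]).

Definition of_C {R : realType} (z : R[i]) : bicomplex R := z +i* 0.
Notation "z %:BC" := (of_C z) (at level 1, left associativity, format "z %:BC")
  : ring_scope.

Section Bicomplex.
Context {R : realType}.
Implicit Types (z : R[i]) (w : bicomplex R).

Definition i1 : bicomplex R := (0 +i* 1)%:BC.
Definition i2 : bicomplex R := 0 +i* 1.
Definition jj : bicomplex R := i1 * i2.
Definition e1 : bicomplex R := (2^-1)%:BC * (1 + jj).
Definition e2 : bicomplex R := (2^-1)%:BC * (1 - jj).

(* z1 + z2 i2 = (z1 - i1 z2) e1 + (z1 + i1 z2) e2; see [idempotentE] and
   [idempotent_uniq]. *)
Definition P1 w : R[i] := Re w - (0 +i* 1) * Im w.
Definition P2 w : R[i] := Re w + (0 +i* 1) * Im w.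

Definition dagger3 w : bicomplex R :=
  (conjc (P1 w))%:BC * e1 + (conjc (P2 w))%:BC * e2.

Definition Dplus : set (bicomplex R) :=
  [set w | exists x1 x2 : R,
     [/\ 0 <= x1, 0 <= x2 & w = (x1%:C)%:BC * e1 + (x2%:C)%:BC * e2]].

Lemma bicomplex_eq (w w' : bicomplex R) : P1 w = P1 w' -> P2 w = P2 w' -> w = w'.
Proof.
case: w w' => [[a b] [c d]] [[a' b'] [c' d']].
rewrite /P1 /P2 => /eqP + /eqP; rewrite !eq_complex /=.
move=> /andP[/eqP h1 /eqP h2] /andP[/eqP h3 /eqP h4].
by congr (_ +i* _); congr (_ +i* _); lra.
Qed.

Local Ltac cring :=
  apply/eqP; rewrite !eq_complex /=; apply/andP; split; apply/eqP; ring.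

Lemma P1D w w' : P1 (w + w') = P1 w + P1 w'.
Proof. by case: w w' => [[a b] [c d]] [[a' b'] [c' d']]; rewrite /P1; cring. Qed.
Lemma P2D w w' : P2 (w + w') = P2 w + P2 w'.
Proof. by case: w w' => [[a b] [c d]] [[a' b'] [c' d']]; rewrite /P2; cring. Qed.
Lemma P1M w w' : P1 (w * w') = P1 w * P1 w'.
Proof. by case: w w' => [[a b] [c d]] [[a' b'] [c' d']]; rewrite /P1; cring. Qed.
Lemma P2M w w' : P2 (w * w') = P2 w * P2 w'.
Proof. by case: w w' => [[a b] [c d]] [[a' b'] [c' d']]; rewrite /P2; cring. Qed.
Lemma P1C z : P1 z%:BC = z. Proof. by rewrite /P1 mulr0 subr0. Qed.
Lemma P2C z : P2 z%:BC = z. Proof. by rewrite /P2 mulr0 addr0. Qed.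
Lemma P1_0 : P1 0 = 0. Proof. exact: (P1C 0). Qed.
Lemma P2_0 : P2 0 = 0. Proof. exact: (P2C 0). Qed.
Lemma P1_1 : P1 1 = 1. Proof. exact: (P1C 1). Qed.
Lemma P2_1 : P2 1 = 1. Proof. exact: (P2C 1). Qed.
Lemma P1N w : P1 (- w) = - P1 w.
Proof. by apply/eqP; rewrite -subr_eq0 opprK -P1D addNr P1_0. Qed.
Lemma P2N w : P2 (- w) = - P2 w.
Proof. by apply/eqP; rewrite -subr_eq0 opprK -P2D addNr P2_0. Qed.
Lemma ii1 : (0 +i* 1) * (0 +i* 1) = -1 :> R[i].
Proof. by cring. Qed.
Lemma P1jj : P1 jj = 1.
Proof. by rewrite /jj P1M P1C /P1/= mulr1 sub0r mulrN ii1 opprK. Qed.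
Lemma P2jj : P2 jj = -1.
Proof. by rewrite /jj P2M P2C /P2/= mulr1 add0r ii1. Qed.
Lemma P1e1 : P1 e1 = 1.
Proof. by rewrite /e1 P1M P1C P1D P1_1 P1jj mulVf ?pnatr_eq0. Qed.
Lemma P2e1 : P2 e1 = 0.
Proof. by rewrite /e1 P2M P2C P2D P2_1 P2jj subrr mulr0. Qed.
Lemma P1e2 : P1 e2 = 0.
Proof. by rewrite /e2 P1M P1C P1D P1N P1_1 P1jj subrr mulr0. Qed.
Lemma P2e2 : P2 e2 = 1.
Proof. by rewrite /e2 P2M P2C P2D P2N P2_1 P2jj opprK mulVf ?pnatr_eq0. Qed.

Definition PE := (P1D, P2D, P1M, P2M, P1N, P2N, P1C, P2C, P1_0, P2_0, P1_1, P2_1,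
  P1e1, P2e1, P1e2, P2e2, mulr1, mulr0, addr0, add0r).

Lemma i1_sqr : i1 * i1 = -1.
Proof. by apply: bicomplex_eq; rewrite !PE ii1. Qed.

Lemma i2_sqr : i2 * i2 = -1.
Proof.
by apply: bicomplex_eq; rewrite !PE /P1 /P2 /= mulr1 ?add0r ?sub0r ?mulrNN ii1.
Qed.

Lemma bicomplexE (z1 z2 : R[i]) : (z1 +i* z2 : bicomplex R) = z1%:BC + z2%:BC * i2.
Proof. by apply: bicomplex_eq; rewrite !PE /P1 /P2 /= mulr1 mulrC; ring. Qed.

Lemma idempotentE w : w = (P1 w)%:BC * e1 + (P2 w)%:BC * e2.
Proof. by apply: bicomplex_eq; rewrite !PE. Qed.

Lemma idempotent_uniq w z z' :
  w = z%:BC * e1 + z'%:BC * e2 -> z = P1 w /\ z' = P2 w.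
Proof. by move=> ->; rewrite !PE. Qed.

Lemma dagger3_mulE w w' :
  dagger3 w * w' = e1 * (conjc (P1 w) * P1 w')%:BC + e2 * (conjc (P2 w) * P2 w')%:BC.
Proof. by apply: bicomplex_eq; rewrite !PE ?mul0r ?mul1r ?addr0 ?add0r. Qed.

End Bicomplex.

Section BicomplexHilbert.
Context {R : realType} {M : lmodType (bicomplex R)}.
Variable ip : M -> M -> bicomplex R.

Record bicomplex_scalar_product : Prop := BicomplexScalarProduct {
  ipDr : forall psi phi chi, ip psi (phi + chi) = ip psi phi + ip psi chi;
  ipZr : forall (alpha : bicomplex R) psi phi,
    ip psi (alpha *: phi) = alpha * ip psi phi;
  ip_dagger : forall psi phi, ip psi phi = dagger3 (ip phi psi);
  ip_eq0 : forall psi, ip psi psi = 0 <-> psi = 0;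
  ip_Dplus : forall psi, Dplus (ip psi psi) }.

(* P1 and P2 take values in R[i]; [Re] only changes the type, since the sum is a
   nonnegative real when [ip] is hyperbolic positive. *)
Definition Tnorm (phi : M) : R :=
  (Num.sqrt 2)^-1 *
  Num.sqrt (Re (P1 (ip (e1 *: phi) (e1 *: phi)) +
                P2 (ip (e2 *: phi) (e2 *: phi)))).

Definition Tcauchy (u : nat -> M) : Prop :=
  forall eps : R, 0 < eps -> exists N : nat, forall m n : nat,
    (N <= m)%N -> (N <= n)%N -> Tnorm (u m - u n) < eps.

Definition Tcvg_to (u : nat -> M) (l : M) : Prop :=
  (fun n => Tnorm (u n - l)) @ \oo --> (0 : R).

Definition Tcomplete : Prop :=
  forall u : nat -> M, Tcauchy u -> exists l : M, Tcvg_to u l.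

Definition bicomplex_hilbert_space : Prop :=
  bicomplex_scalar_product /\ Tcomplete.

End BicomplexHilbert.

Section L2.
Context {R : realType}.
Local Notation mu := (@lebesgue_measure R).

(* [Lfun mu 2] only covers real-valued functions; a function into C(i1) is
   measurable when its real and imaginary parts are. *)
Definition L2_C (f : R -> R[i]) : Prop :=
  [/\ measurable_fun setT (fun x => Re (f x)),
      measurable_fun setT (fun x => Im (f x)) &
      finite_norm mu 2%:E (fun x => Normc.normc (f x))].

(* The values of a function R -> T are taken in the regular module T^o, so that
   [a *: f] is the pointwise product. *)
Local Notation Tfun := (R -> (bicomplex R)^o).

(* P1 \o f and P2 \o f are the components of f = e1 u1 + e2 u2. *)
Definition L2_T : {pred Tfun} :=
  fun f => `[< L2_C (fun x => P1 (f x)) /\ L2_C (fun x => P2 (f x)) >].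

Lemma finite_norm_le (f g : R -> R) : measurable_fun setT f ->
  (forall x, `|f x| <= `|g x|) -> g \in Lfun mu 2%:E -> f \in Lfun mu 2%:E.
Proof.
move=> mf fg gL; rewrite inE; apply/andP; split; rewrite inE//=.
move: gL; rewrite inE => /andP[]; rewrite !inE/= => mg.
rewrite /finite_norm => ng; apply: le_lt_trans ng.
rewrite unlock; apply: gt0_ler_poweR.
- by rewrite invr_ge0.
- by rewrite in_itv/= leey integral_ge0// => x _; exact: poweR_ge0.
- by rewrite in_itv/= leey integral_ge0// => x _; exact: poweR_ge0.
have m2 (h : R -> R) : measurable_fun setT h ->
    measurable_fun setT (EFin \o (fun x : R => `|h x| `^ 2)).
  move=> mh; apply/measurable_EFinP.
  apply: (measurableT_comp (measurable_powR _)).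
  exact: measurableT_comp.
apply: ge0_le_integral.
- exact: measurableT.
- by move=> x _; exact: poweR_ge0.
- exact: (m2 f mf).
- exact: (m2 g mg).
- by move=> x _ /=; rewrite lee_fin ge0_ler_powR// ?nnegrE.
Qed.

Lemma normc_triangle (z : R[i]) : [/\ `|Re z| <= Normc.normc z,
  `|Im z| <= Normc.normc z, 0 <= Normc.normc z &
  Normc.normc z <= `|Re z| + `|Im z|].
Proof.
case: z => a b /=; split=> //.
- by rewrite -sqrtr_sqr ler_wsqrtr// lerDl sqr_ge0.
- by rewrite -sqrtr_sqr ler_wsqrtr// lerDr sqr_ge0.
- rewrite -[leRHS]ger0_norm ?addr_ge0// -sqrtr_sqr ler_wsqrtr//.
  by rewrite sqrrD !real_normK ?num_real// lerD2r lerDl mulrn_wge0 ?mulr_ge0.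
Qed.

Lemma L2_CP (f : R -> R[i]) : L2_C f <->
  (fun x => Re (f x)) \in Lfun mu 2%:E /\ (fun x => Im (f x)) \in Lfun mu 2%:E.
Proof.
have mem_Lfun (h : R -> R) : measurable_fun setT h -> finite_norm mu 2%:E h ->
    h \in Lfun mu 2%:E.
  by move=> mh nh; rewrite inE; apply/andP; split; rewrite inE.
have mN : measurable_fun setT (fun x => Re (f x)) ->
    measurable_fun setT (fun x => Im (f x)) ->
    measurable_fun setT (fun x => Normc.normc (f x)).
  move=> mr mi.
  rewrite (_ : (fun x => _) = (fun x => Num.sqrt (Re (f x) ^+ 2 + Im (f x) ^+ 2))).
    apply: (measurableT_comp (f := @Num.sqrt R)).
      by apply: continuous_measurable_fun; exact: sqrt_continuous.
    by apply: measurable_funD; exact: measurable_funX.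
  by apply/funext => x; case: (f x).
split=> [[mr mi nf]|[Lr Li]].
- have NL : (fun x => Normc.normc (f x)) \in Lfun mu 2%:E by apply: mem_Lfun => //; exact: mN.
  by split; apply: finite_norm_le NL => // x;
    have [? ? ? _] := normc_triangle (f x); rewrite (@ger0_norm _ (Normc.normc _)).
- have mr : measurable_fun setT (fun x => Re (f x)).
    by move: Lr; rewrite inE => /andP[]; rewrite inE.
  have mi : measurable_fun setT (fun x => Im (f x)).
    by move: Li; rewrite inE => /andP[]; rewrite inE.
  split=> //.
  have abs_Lfun (h : R -> R) : h \in Lfun mu 2%:E -> (fun x => `|h x|) \in Lfun mu 2%:E.
    move=> hL; apply: (finite_norm_le _ _ hL) => [|x]; last by rewrite normr_id.
    apply: measurableT_comp => //.
    by move: hL; rewrite inE => /andP[]; rewrite inE.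
  have : (fun x => Normc.normc (f x)) \in Lfun mu 2%:E.
    apply: (finite_norm_le (g := (fun x => `|Re (f x)|) \+ (fun x => `|Im (f x)|))).
    + exact: mN.
    + move=> x; have [_ _ ? ?] := normc_triangle (f x).
      by rewrite !ger0_norm //= addr_ge0.
    + have [_ lin] := Lfun_submod_closed mu (lee1n 2 : (1 <= 2%:E :> \bar R)%E).
      have := lin 1 _ _ (abs_Lfun _ Lr) (abs_Lfun _ Li).
      by rewrite scale1r.
  by rewrite inE => /andP[_]; rewrite inE.
Qed.

Lemma L2_C_linear (a : R[i]) (f g : R -> R[i]) :
  L2_C f -> L2_C g -> L2_C (fun x => a * f x + g x).
Proof.
move=> /L2_CP[fr fi] /L2_CP[gr gi].
have Lcomb (b c : R) (h k l : R -> R) : h \in Lfun mu 2%:E -> k \in Lfun mu 2%:E ->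
    l \in Lfun mu 2%:E -> (fun x => b * h x + c * k x + l x) \in Lfun mu 2%:E.
  move=> hL kL lL; have [_ lin] := Lfun_submod_closed mu (lee1n 2).
  have := lin b h (c *: k + l) hL (lin c k l kL lL).
  by rewrite addrA.
apply/L2_CP; split.
- rewrite (_ : (fun x => _) =
    (fun x => Re a * Re (f x) + - Im a * Im (f x) + Re (g x))); first exact: Lcomb.
  by apply/funext => x; case: a (f x) (g x) => [p q] [? ?] [? ?] /=; ring.
- rewrite (_ : (fun x => _) =
    (fun x => Re a * Im (f x) + Im a * Re (f x) + Im (g x))); first exact: Lcomb.
  by apply/funext => x; case: a (f x) (g x) => [p q] [? ?] [? ?] /=; ring.
Qed.

Lemma L2_C0 : L2_C (fun=> 0).
Proof.
by apply/L2_CP; split=> /=; have [+ _] := Lfun_submod_closed mu (lee1n 2).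
Qed.

Lemma L2_T_submod_closed : submod_closed L2_T.
Proof.
split.
  by apply/asboolP; split; [under eq_fun do rewrite P1_0|under eq_fun do rewrite P2_0];
    exact: L2_C0.
move=> a f g /asboolP[f1 f2] /asboolP[g1 g2]; apply/asboolP; split.
- rewrite (_ : (fun x => _) = (fun x => P1 a * P1 (f x) + P1 (g x))).
    exact: L2_C_linear.
  by apply/funext => x; rewrite P1D P1M.
- rewrite (_ : (fun x => _) = (fun x => P2 a * P2 (f x) + P2 (g x))).
    exact: L2_C_linear.
  by apply/funext => x; rewrite P2D P2M.
Qed.

HB.instance Definition _ :=
  GRing.isSubmodClosed.Build (bicomplex R) Tfun L2_T L2_T_submod_closed.

Record L2fun := MkL2fun { L2fun_val :> Tfun ; _ : L2fun_val \in L2_T }.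
HB.instance Definition _ := [isSub for L2fun_val].
HB.instance Definition _ := [Choice of L2fun by <:].
HB.instance Definition _ := [SubChoice_isSubLmodule of L2fun by <:].

Lemma L2fun_valD (f g : L2fun) : (f + g : L2fun) = (f : Tfun) + g :> Tfun.
Proof. exact: (raddfD (val : L2fun -> Tfun)). Qed.
Lemma L2fun_valN (f : L2fun) : (- f : L2fun) = - (f : Tfun) :> Tfun.
Proof. exact: (raddfN (val : L2fun -> Tfun)). Qed.
Lemma L2fun_valZ (a : bicomplex R) (f : L2fun) :
  (a *: f : L2fun) = a *: (f : Tfun) :> Tfun.
Proof. by []. Qed.

Definition ae_eq_L2 (f g : L2fun) : bool := `[< (f : Tfun) = g %[ae mu] >].

Lemma ae_eq_L2_refl : reflexive ae_eq_L2.
Proof. by move=> f; apply/asboolP; exact: ae_eq_refl. Qed.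

Lemma ae_eq_L2_sym : symmetric ae_eq_L2.
Proof. by move=> f g; apply/idP/idP => /asboolP h; apply/asboolP/ae_eq_sym. Qed.

Lemma ae_eq_L2_trans : transitive ae_eq_L2.
Proof.
by move=> f g h /asboolP gf /asboolP fh; apply/asboolP/(ae_eq_trans gf fh).
Qed.

Canonical ae_eq_L2_equiv :=
  EquivRel ae_eq_L2 ae_eq_L2_refl ae_eq_L2_sym ae_eq_L2_trans.

Definition L2 : Type := {eq_quot ae_eq_L2}.
HB.instance Definition _ := Choice.on L2.
HB.instance Definition _ := EqQuotient.on L2.

Lemma L2_ind (P : L2 -> Prop) : (forall f, P (\pi_L2 f)) -> forall u, P u.
Proof. by move=> Ppi u; rewrite -[u]reprK. Qed.

Lemma pi_L2P (f g : L2fun) : \pi_L2 f = \pi_L2 g <-> (f : Tfun) = g %[ae mu].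
Proof.
split=> [/eqP|fg]; first by rewrite eqmodE => /asboolP.
by apply/eqP; rewrite eqmodE; exact/asboolP.
Qed.

Lemma reprL2_ae (f : L2fun) : (repr (\pi_L2 f) : Tfun) = f %[ae mu].
Proof. by apply/pi_L2P; rewrite reprK. Qed.

Definition L2_zero : L2 := \pi_L2 0.
Definition L2_opp (u : L2) : L2 := \pi_L2 (- repr u).
Definition L2_add (u v : L2) : L2 := \pi_L2 (repr u + repr v).
Definition L2_scale (a : bicomplex R) (u : L2) : L2 := \pi_L2 (a *: repr u).

Let ae_filter : Filter (almost_everywhere mu).
Proof. exact: ae_filter_ringOfSetsType. Qed.
#[local] Existing Instance ae_filter.

Lemma pi_L2D f g : L2_add (\pi_L2 f) (\pi_L2 g) = \pi_L2 (f + g).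
Proof.
apply/pi_L2P; have := reprL2_ae f; have := reprL2_ae g.
by apply: filterS2 => x hg hf _; rewrite !L2fun_valD /= [LHS]/(_ + _)%R hg// hf.
Qed.

Lemma pi_L2N f : L2_opp (\pi_L2 f) = \pi_L2 (- f).
Proof.
apply/pi_L2P; have := reprL2_ae f.
by apply: filterS => x hf _; rewrite !L2fun_valN [LHS]/(- _)%R hf.
Qed.

Lemma pi_L2Z a f : L2_scale a (\pi_L2 f) = \pi_L2 (a *: f).
Proof.
apply/pi_L2P; have := reprL2_ae f.
by apply: filterS => x hf _; rewrite !L2fun_valZ [LHS]/(_ *: _)%R hf.
Qed.

Lemma L2_addA : associative L2_add.
Proof. move=> u v w; elim/L2_ind: u => f; elim/L2_ind: v => g; elim/L2_ind: w => h; by rewrite !pi_L2D addrA. Qed.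
Lemma L2_addC : commutative L2_add.
Proof. move=> u v; elim/L2_ind: u => f; elim/L2_ind: v => g; by rewrite !pi_L2D addrC. Qed.
Lemma L2_add0 : left_id L2_zero L2_add.
Proof. move=> u; elim/L2_ind: u => f; by rewrite pi_L2D add0r. Qed.
Lemma L2_addN : left_inverse L2_zero L2_opp L2_add.
Proof. move=> u; elim/L2_ind: u => f; by rewrite pi_L2N pi_L2D addNr. Qed.

HB.instance Definition _ :=
  GRing.isZmodule.Build L2 L2_addA L2_addC L2_add0 L2_addN.

Lemma L2_scaleA a b u : L2_scale a (L2_scale b u) = L2_scale (a * b) u.
Proof. by elim/L2_ind: u => f; rewrite !pi_L2Z scalerA. Qed.
Lemma L2_scale1 : left_id 1 L2_scale.
Proof. move=> u; elim/L2_ind: u => f; by rewrite pi_L2Z scale1r. Qed.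
Lemma L2_scaleDr : right_distributive L2_scale +%R.
Proof.
move=> a u v; elim/L2_ind: u => f; elim/L2_ind: v => g.
rewrite -[LHS]/(L2_scale a (L2_add _ _)) -[RHS]/(L2_add _ _).
by rewrite pi_L2D !pi_L2Z pi_L2D scalerDr.
Qed.
Lemma L2_scaleDl u : {morph L2_scale^~ u : a b / a + b}.
Proof.
move=> a b; elim/L2_ind: u => f; rewrite -[RHS]/(L2_add _ _).
by rewrite !pi_L2Z pi_L2D scalerDl.
Qed.

HB.instance Definition _ := GRing.Zmodule_isLmodule.Build (bicomplex R) L2
  L2_scaleA L2_scale1 L2_scaleDr L2_scaleDl.

Definition integral_C (f : R -> R[i]) : R[i] :=
  (\int[mu]_x Re (f x))%R +i* (\int[mu]_x Im (f x))%R.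

Definition integral_T (f : R -> bicomplex R) : bicomplex R :=
  integral_C (fun x => Re (f x)) +i* integral_C (fun x => Im (f x)).

(* The value does not depend on the representatives, since functions that are
   equal almost everywhere have the same integral. *)
Definition L2_ip (u v : L2) : bicomplex R :=
  integral_T (fun x : R => dagger3 ((repr u : L2fun) x) * (repr v : L2fun) x).

Lemma L2_ipE (u v : L2) : L2_ip u v = integral_T (fun x : R =>
  e1 * (conjc (P1 ((repr u : L2fun) x)) * P1 ((repr v : L2fun) x))%:BC +
  e2 * (conjc (P2 ((repr u : L2fun) x)) * P2 ((repr v : L2fun) x))%:BC).
Proof. by congr integral_T; apply/funext => x; exact: dagger3_mulE. Qed.

End L2.

Arguments L2 : clear implicits.

(* Main.v *)
(* In idempotent coordinates (u, v) is e1 (u1, v1) + e2 (u2, v2), with (.,.) the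
   L^2 inner product of complex functions, so everything reduces to the four
   real components. Their completeness is the Riesz-Fischer theorem: a Cauchy
   sequence has a subsequence f_k with ||f_{k+1} - f_k||^2 < 4^-k, hence
   sum_k 2^k (f_{k+1} - f_k)^2 is integrable and so finite almost everywhere;
   there f_k converges, and Fatou's lemma turns pointwise convergence into
   convergence in L^2. *)
Require Import Defs.
From mathcomp Require Import all_boot all_order all_algebra.
From mathcomp Require Import all_classical all_reals all_analysis.
From mathcomp Require Import ring lra measurable_realfun complex.

Set Implicit Arguments.
Unset Strict Implicit.
Unset Printing Implicit Defensive.

Import Order.TTheory GRing.Theory Num.Theory.
Import numFieldNormedType.Exports.

Local Open Scope classical_set_scope.
Local Open Scope ring_scope.

(** * Square-integrable real functions *)

Section SquareIntegrable.
Context d (T : measurableType d) (R : realType) (mu : {measure set T -> \bar R}).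
Implicit Types f g : T -> R.

Lemma Lfun2_measurable f : f \in Lfun mu 2%:E -> measurable_fun setT f.
Proof. by rewrite inE => /andP[]; rewrite inE. Qed.

Lemma Lfun2_sqrP f : measurable_fun setT f ->
  (\int[mu]_x (f x ^+ 2)%:E < +oo)%E -> f \in Lfun mu 2%:E.
Proof.
move=> mf intf; rewrite inE; apply/andP; split; rewrite inE//=.
rewrite /finite_norm unlock; apply: poweR_lty.
apply: le_lt_trans intf; rewrite le_eqVlt; apply/orP; left; apply/eqP.
apply: eq_integral => x _ /=.
by rewrite powR_mulrn// real_normK// num_real.
Qed.

Lemma Lfun2B f g : f \in Lfun mu 2%:E -> g \in Lfun mu 2%:E ->
  (fun x => f x - g x) \in Lfun mu 2%:E.
Proof.
have [_ lin] := Lfun_submod_closed mu (lee1n 2 : (1 <= 2%:E :> \bar R)%E).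
move=> fL gL; suff -> : (fun x => f x - g x) = (-1 : R) *: g + f by exact: lin.
by apply/funext => x; rewrite -[RHS]/(-1 * g x + f x) mulN1r addrC.
Qed.

Lemma Lfun2_mul_integrable f g : f \in Lfun mu 2%:E -> g \in Lfun mu 2%:E ->
  mu.-integrable setT (EFin \o (fun x => f x * g x)).
Proof. by move=> fL gL; apply/Lfun1_integrable/Lfun2_mul_Lfun1. Qed.

Lemma EFin_Rintegral f : mu.-integrable setT (EFin \o f) ->
  (\int[mu]_x f x)%:E = (\int[mu]_x (f x)%:E)%E.
Proof. by move=> fi; rewrite /Rintegral fineK//; exact: integrable_fin_num. Qed.

End SquareIntegrable.

(** * Riesz-Fischer completeness for real functions *)

Section RieszFischer.
Context d (T : measurableType d) (R : realType) (mu : {measure set T -> \bar R}).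
Implicit Types f : nat -> T -> R.

(** Serves for the right-hand side of Fatou's inequality, where a bound is known only for large
    indices. The infimum over the tail starting at [n] is at most [u n], and [N <= n] holds
    eventually. *)
Lemma limn_einf_le (u : (\bar R)^nat) (a : \bar R) (N : nat) :
  (forall n, (N <= n)%N -> u n <= a)%E -> (limn_einf u <= a)%E.
Proof.
move=> ua; rewrite limn_einf_lim; apply: lime_le; first exact: is_cvg_einfs.
near=> n; apply: ge_ereal_inf; exists (u n); last by apply: ua; near: n; exists N.
by exists n => /=.
Unshelve. all: by end_near. Qed.

Lemma fast_cauchy_subsequence (D : nat -> nat -> R) (eps : nat -> R) :
  (forall k, 0 < eps k) ->
  (forall e : R, 0 < e -> exists N : nat, forall m n,
     (N <= m)%N -> (N <= n)%N -> D m n < e) ->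
  exists s : nat -> nat, (forall k, (k <= s k)%N) /\
    (forall k, D (s k.+1) (s k) < eps k).
Proof.
move=> eps0 cauchyD.
have [N NP] := choice (fun k => cauchyD _ (eps0 k)).
(* The sum makes both [s k] and [s k.+1] at least [N k]; the summand [k] forces [s] to infinity even
   if every [N i] is 0. *)
exists (fun k => (k + \sum_(i < k.+1) N i)%N); split=> [k|k]; first exact: leq_addr.
apply: NP; last by rewrite big_ord_recr/= addnA leq_addl.
by rewrite 2!big_ord_recr/= [X in (_ <= _ + X)%N]addnAC addnA leq_addl.
Qed.

Lemma sum_half_le2 n : \sum_(0 <= k < n) 2^-1 ^+ k <= 2 :> R.
Proof.
have half_lt1 : `|2^-1 : R| < 1 by rewrite ger0_norm ?invr_ge0// invf_lt1// ltr1n.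
have := @geometric_le_lim R n 1 2^-1 ler01 (ltac:(by rewrite invr_gt0)) half_lt1.
rewrite mul1r (_ : 1 - 2^-1 = 2^-1) ?invrK; last by lra.
by move=> h; apply: le_trans h; apply: ler_sum => k _ /=; rewrite mul1r.
Qed.

(* AM-GM bounds |u k.+1 - u k| by (2^k (u k.+1 - u k)^2 + 2^-k) / 2. *)
Lemma cvgn_weighted_square_increments (u : R^nat) :
  (\sum_(0 <= k <oo) (2 ^+ k * (u k.+1 - u k) ^+ 2)%:E < +oo)%E -> cvgn u.
Proof.
move=> sfin.
suff : cvgn (series (telescope u)).
  have uE : u = cst (u 0%N) + series (telescope u).
    by apply/funext => n; rewrite [LHS]eq_sum_telescope.
  by move=> cu; rewrite uE; apply: is_cvgD => //; exact: is_cvg_cst.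
apply: normed_cvg; set S := (\sum_(0 <= k <oo) _)%E in sfin.
have w0 k : (0 <= (2 ^+ k * (u k.+1 - u k) ^+ 2)%:E)%E.
  by rewrite lee_fin mulr_ge0 ?sqr_ge0.
have S0 : (0 <= S)%E by exact: nneseries_ge0.
have Sfin : S \is a fin_num by rewrite ge0_fin_numE.
apply: nondecreasing_is_cvgn.
  by apply: nondecreasing_series => k _ _ /=; rewrite normr_ge0.
(* [fine S] bounds the weighted squares and 2 the geometric sum; the factor 1/2 from AM-GM is given
   away. *)
exists (fine S + 2) => _ [n _ <-].
apply: (@le_trans _ _
  (\sum_(0 <= k < n) (2 ^+ k * (u k.+1 - u k) ^+ 2 + 2^-1 ^+ k))).
  rewrite /series/=; apply: ler_sum => k _.
  rewrite /telescope; set x := u k.+1 - u k.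
  have a0 : 0 < 2 ^+ k :> R by rewrite exprn_gt0.
  rewrite exprVn.
  have -> : x ^+ 2 = `|x| ^+ 2 by rewrite real_normK// num_real.
  have : 0 <= (2 ^+ k * `|x| - 1) ^+ 2 by rewrite sqr_ge0.
  have : 0 <= `|x| by [].
  move: (2 ^+ k : R) `|x| a0 => a y a0 y0 h.
  rewrite -(ler_pM2l a0) mulrDr divff ?gt_eqF//.
  by nra.
rewrite big_split/= lerD//.
  by rewrite -lee_fin fineK// -sumEFin; apply: nneseries_lim_ge => k _ _; exact: w0.
exact: sum_half_le2.
Qed.

Lemma Lfun2_complete f : (forall n, f n \in Lfun mu 2%:E) ->
  (forall e : R, 0 < e -> exists N : nat, forall m n, (N <= m)%N -> (N <= n)%N ->
    \int[mu]_x (f m x - f n x) ^+ 2 < e) ->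
  exists2 g, g \in Lfun mu 2%:E &
    (fun n => \int[mu]_x (f n x - g x) ^+ 2) @ \oo --> (0:R).
Proof.
move=> fL fC.
have fB2 m n : mu.-integrable setT (EFin \o (fun x => (f m x - f n x) ^+ 2)).
  exact/Lfun2_integrable_sqr/Lfun2B.
(* The rate 4^-k leaves room for the weight 2^k: the integral of [w k] is at most 2^k 4^-k = 2^-k,
   so that of [G] is at most 2. *)
have [s [s_ge sC]] := fast_cauchy_subsequence
  (fun k => exprn_gt0 k (ltac:(by rewrite invr_gt0 ltr0n) : 0 < 4^-1 :> R)) fC.
have mf n : measurable_fun setT (f n) by exact: (@Lfun2_measurable _ _ _ mu).
have mfB m n : measurable_fun setT (EFin \o (fun x => (f m x - f n x) ^+ 2)).
  exact: measurable_int (fB2 m n).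
pose w k x : \bar R := (2 ^+ k * (f (s k.+1) x - f (s k) x) ^+ 2)%:E.
have w0 k x : (0 <= w k x)%E by rewrite lee_fin mulr_ge0 ?sqr_ge0.
have mw k : measurable_fun setT (w k).
  by apply/measurable_EFinP; apply: measurable_funM => //; exact/measurable_EFinP.
pose G x := (\sum_(0 <= k <oo) w k x)%E.
have mG : measurable_fun setT G by exact: ge0_emeasurable_sum.
have G0 x : (0 <= G x)%E by exact: nneseries_ge0.
have intG : mu.-integrable setT G.
  apply/integrableP; split=> //.
  under eq_integral do rewrite gee0_abs//.
  rewrite integral_nneseries//; apply: (@le_lt_trans _ _ 2%:E); last exact: ltry.
  apply: lime_le.
    by apply: is_cvg_nneseries => k _ _; exact: integral_ge0.
  apply: nearW => n.
  apply: (@le_trans _ _ (\sum_(0 <= k < n) (2^-1 ^+ k)%:E)%E).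
    apply: lee_sum => k _.
    under eq_integral do rewrite /w EFinM.
    rewrite ge0_integralZl//; [|exact: mfB|by move=> x _; rewrite lee_fin sqr_ge0].
    rewrite -EFin_Rintegral// -EFinM lee_fin.
    rewrite (_ : 2^-1 = 2 * 4^-1); last by lra.
    by rewrite exprMn ler_pM2l ?exprn_gt0// ltW.
  by rewrite sumEFin lee_fin sum_half_le2.
pose A := [set x | (G x < +oo)%E].
(* Cutting off outside [A] makes [h] converge at every point, with limit 0 off [A], so that the
   limit [g] is measurable as an everywhere pointwise limit. *)
pose h k x := f (s k) x * \1_A x.
have mA : measurable A.
  by rewrite -[A]setTI; exact: emeasurable_fun_infty_o.
have mh k : measurable_fun setT (h k).
  by apply: measurable_funM => //; exact: measurable_indic.
have hcvg x : cvgn (h ^~ x).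
  rewrite /h indicE; have [xA|xA] := boolP (x \in A).
    have := cvgn_weighted_square_increments (set_mem xA).
    by under [in X in _ -> X]eq_fun do rewrite mulr1.
  by under eq_fun do rewrite mulr0; exact: is_cvg_cst.
pose g x := limn (h ^~ x).
have mg : measurable_fun setT g.
  by apply: (measurable_fun_cvg mh) => x _; exact: hcvg.
have Aae : \forall x \ae mu, A x.
  apply: filterS (integrable_ae measurableT intG) => x /(_ I).
  by rewrite ge0_fin_numE.
(* Fatou with [n] fixed: the integrand is the limit inferior over [k] of [(f n - h k) ^+ 2], so a
   bound valid for all large [k] survives in the limit. *)
have intfg n e N : (forall k, (N <= k)%N -> \int[mu]_x (f n x - f (s k) x) ^+ 2 <= e) ->
    (\int[mu]_x ((f n x - g x) ^+ 2)%:E <= e%:E)%E.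
  move=> fe.
  have -> : (\int[mu]_x ((f n x - g x) ^+ 2)%:E =
      \int[mu]_x limn_einf (fun k => ((f n x - h k x) ^+ 2)%:E))%E.
    apply: eq_integral => x _; apply/esym.
    apply: (fun H => (cvg_limn_einf_sup H).1); apply: cvg_EFin; first exact: nearW.
    apply: (continuous_cvg _ (@exprn_continuous _ 2 _)).
    by apply: cvgB; [exact: cvg_cst|exact: hcvg].
  apply: le_trans (fatou mu _ _ _) _ => //.
  - move=> k; apply/measurable_EFinP; apply: measurable_funX.
    exact: measurable_funB.
  - by move=> k x _; rewrite lee_fin sqr_ge0.
  apply: (@limn_einf_le _ _ N) => k Nk.
  (* On [A], whose complement is null, [h k] coincides with [f (s k)]. *)
  rewrite (@ae_eq_integral _ _ _ _ _ (EFin \o (fun x => (f n x - f (s k) x) ^+ 2))) //.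
  - by rewrite -EFin_Rintegral// lee_fin fe.
  - apply/measurable_EFinP; apply: measurable_funX; exact: measurable_funB.
  - apply: filterS Aae => x Ax _ /=.
    by rewrite /h indicE mem_set// mulr1.
have fgL n e N : (forall k, (N <= k)%N -> \int[mu]_x (f n x - f (s k) x) ^+ 2 <= e) ->
    (fun x => f n x - g x) \in Lfun mu 2%:E.
  move=> /intfg fge; apply: Lfun2_sqrP; first exact: measurable_funB.
  by apply: le_lt_trans fge _; exact: ltry.
have sle e n N : (forall i j, (N <= i)%N -> (N <= j)%N ->
      \int[mu]_x (f i x - f j x) ^+ 2 < e) ->
    (N <= n)%N -> forall k, (N <= k)%N -> \int[mu]_x (f n x - f (s k) x) ^+ 2 <= e.
  by move=> fe Nn k Nk; apply/ltW/fe => //; exact: leq_trans (s_ge k).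
(* A single index [N], taken from the Cauchy condition with bound 1, suffices: [f N - g] is square
   integrable by [fgL], and so is [f N]. *)
have gL : g \in Lfun mu 2%:E.
  have [N /sle/(_ (leqnn N))/fgL fNg] := fC 1 ltr01.
  rewrite (_ : g = fun x => f N x - (f N x - g x)); first exact: Lfun2B.
  by apply/funext => x; rewrite subKr.
(* The whole sequence converges, not just the subsequence: in [intfg] the index [n] is arbitrary and
   only [s k] runs along the subsequence. *)
exists g => //; apply/cvgrPdist_le => e e0.
have [N /sle NP] := fC e e0.
exists N => // n /= /NP /intfg.
rewrite -EFin_Rintegral; last exact/Lfun2_integrable_sqr/Lfun2B.
rewrite lee_fin sub0r normrN ger0_norm//.
by apply: Rintegral_ge0 => x _; exact: sqr_ge0.
Qed.

End RieszFischer.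

Local Open Scope complex_scope.

Local Notation Re := complex.Re.
Local Notation Im := complex.Im.

(** * Integration and the L^2 inner product for complex functions *)

Section ComplexIntegral.
Context {R : realType}.
Local Notation mu := (@lebesgue_measure R).
Implicit Types (f g : R -> R[i]) (a : R[i]).

#[local] Instance lebesgue_ae_filter : Filter (almost_everywhere mu).
Proof. exact: ae_filter_ringOfSetsType. Qed.

Definition integrable_C f : Prop :=
  mu.-integrable setT (EFin \o (fun x => Re (f x))) /\
  mu.-integrable setT (EFin \o (fun x => Im (f x))).

Lemma ReD (z w : R[i]) : Re (z + w) = Re z + Re w.
Proof. by case: z w => [? ?] [? ?]. Qed.
Lemma ImD (z w : R[i]) : Im (z + w) = Im z + Im w.
Proof. by case: z w => [? ?] [? ?]. Qed.
Lemma ReM (z w : R[i]) : Re (z * w) = Re z * Re w - Im z * Im w.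
Proof. by case: z w => [? ?] [? ?]. Qed.
Lemma ImM (z w : R[i]) : Im (z * w) = Re z * Im w + Im z * Re w.
Proof. by case: z w => [? ?] [? ?]. Qed.
Lemma complex_ext (z w : R[i]) : Re z = Re w -> Im z = Im w -> z = w.
Proof. by case: z w => [? ?] [? ?] /= -> ->. Qed.

Lemma integrable_lin2 (p q : R) (h k : R -> R) :
  mu.-integrable setT (EFin \o h) -> mu.-integrable setT (EFin \o k) ->
  mu.-integrable setT (EFin \o (fun x => p * h x + q * k x)).
Proof.
move=> hi ki.
rewrite (_ : EFin \o _ = (fun x => p%:E * (h x)%:E) \+ (fun x => q%:E * (k x)%:E))%E //.
by apply: integrableD => //; apply: integrableZl.
Qed.

Lemma Rintegral_lin2 (p q : R) (h k : R -> R) :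
  mu.-integrable setT (EFin \o h) -> mu.-integrable setT (EFin \o k) ->
  \int[mu]_x (p * h x + q * k x) = p * \int[mu]_x h x + q * \int[mu]_x k x.
Proof.
move=> hi ki; rewrite RintegralD ?RintegralZl//.
- exact: (integrableZl measurableT p hi).
- exact: (integrableZl measurableT q ki).
Qed.

Lemma integrable_CD f g :
  integrable_C f -> integrable_C g -> integrable_C (fun x => f x + g x).
Proof.
move=> [fr fi] [gr gi]; split.
- have := integrable_lin2 1 1 fr gr; congr (_.-integrable _ (_ \o _)).
  by apply/funext => x; rewrite ReD !mul1r.
- have := integrable_lin2 1 1 fi gi; congr (_.-integrable _ (_ \o _)).
  by apply/funext => x; rewrite ImD !mul1r.
Qed.

Lemma integrable_CZ a f : integrable_C f -> integrable_C (fun x => a * f x).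
Proof.
move=> [fr fi]; split.
- have := integrable_lin2 (Re a) (- Im a) fr fi; congr (_.-integrable _ (_ \o _)).
  by apply/funext => x; rewrite ReM mulNr.
- have := integrable_lin2 (Re a) (Im a) fi fr; congr (_.-integrable _ (_ \o _)).
  by apply/funext => x; rewrite ImM.
Qed.

Lemma integral_CD f g : integrable_C f -> integrable_C g ->
  integral_C (fun x => f x + g x) = integral_C f + integral_C g.
Proof.
move=> [fr fi] [gr gi]; apply: complex_ext; rewrite ?ReD ?ImD /=.
- by under eq_Rintegral do rewrite ReD; rewrite RintegralD.
- by under eq_Rintegral do rewrite ImD; rewrite RintegralD.
Qed.

Lemma integral_CZ a f : integrable_C f ->
  integral_C (fun x => a * f x) = a * integral_C f.
Proof.
move=> [fr fi]; apply: complex_ext; rewrite ?ReM ?ImM /=.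
- by under eq_Rintegral do rewrite ReM -mulNr; rewrite Rintegral_lin2// mulNr.
- by under eq_Rintegral do rewrite ImM; rewrite Rintegral_lin2.
Qed.

Lemma integral_C_conj f : integrable_C f ->
  integral_C (fun x => conjc (f x)) = conjc (integral_C f).
Proof.
move=> [fr fi]; apply: complex_ext => /=.
- by apply: eq_Rintegral => x _; case: (f x).
- rewrite -mulN1r -RintegralZl//.
  by apply: eq_Rintegral => x _; rewrite mulN1r; case: (f x).
Qed.

Lemma Rintegral_ae (h k : R -> R) :
  mu.-integrable setT (EFin \o h) -> mu.-integrable setT (EFin \o k) ->
  (\forall x \ae mu, h x = k x) -> \int[mu]_x h x = \int[mu]_x k x.
Proof.
move=> hi ki hk; congr fine; apply: ae_eq_integral => //.
- exact: measurable_int hi.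
- exact: measurable_int ki.
- by apply: filterS hk => x xE _ /=; rewrite xE.
Qed.

Lemma integral_C_ae f g : integrable_C f -> integrable_C g ->
  (\forall x \ae mu, f x = g x) -> integral_C f = integral_C g.
Proof.
move=> [fr fi] [gr gi] fg; apply: complex_ext => /=; apply: Rintegral_ae => //;
by apply: filterS fg => x ->.
Qed.

Definition dotC f g : R[i] := integral_C (fun x => conjc (f x) * g x).

(** The real and imaginary parts of the product are sums or differences of products of two real
    square-integrable functions, each integrable by Hölder's inequality. *)
Lemma L2_C_mul f g : L2_C f -> L2_C g -> integrable_C (fun x => conjc (f x) * g x).
Proof.
move=> /L2_CP[fr fi] /L2_CP[gr gi]; split.
- have := integrable_lin2 1 1 (Lfun2_mul_integrable fr gr) (Lfun2_mul_integrable fi gi).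
  congr (_.-integrable _ (_ \o _)); apply/funext => x.
  by case: (f x) (g x) => [? ?] [? ?] /=; ring.
- have := integrable_lin2 1 (-1) (Lfun2_mul_integrable fr gi)
    (Lfun2_mul_integrable fi gr).
  congr (_.-integrable _ (_ \o _)); apply/funext => x.
  by case: (f x) (g x) => [? ?] [? ?] /=; ring.
Qed.

Lemma dotCD f g h : L2_C f -> L2_C g -> L2_C h ->
  dotC f (fun x => g x + h x) = dotC f g + dotC f h.
Proof.
move=> fL gL hL; rewrite /dotC -integral_CD; try exact: L2_C_mul.
by congr integral_C; apply/funext => x; rewrite mulrDr.
Qed.

Lemma dotCZ a f g : L2_C f -> L2_C g -> dotC f (fun x => a * g x) = a * dotC f g.
Proof.
move=> fL gL; rewrite /dotC -integral_CZ; last exact: L2_C_mul.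
by congr integral_C; apply/funext => x; rewrite mulrCA.
Qed.

Lemma dotC_conj f g : L2_C f -> L2_C g -> dotC f g = conjc (dotC g f).
Proof.
move=> fL gL; rewrite /dotC -integral_C_conj; last exact: L2_C_mul.
congr integral_C; apply/funext => x.
by case: (f x) (g x) => [? ?] [? ?]; apply: complex_ext => /=; ring.
Qed.

(** Needed because the chosen representatives of classes obey the algebraic laws only almost
    everywhere. *)
Lemma dotC_ae f f' g g' : L2_C f -> L2_C f' -> L2_C g -> L2_C g' ->
  (\forall x \ae mu, f x = f' x) -> (\forall x \ae mu, g x = g' x) ->
  dotC f g = dotC f' g'.
Proof.
move=> fL fL' gL gL' ff' gg'; apply: integral_C_ae; try exact: L2_C_mul.
by apply: filterS2 ff' gg' => x -> ->.
Qed.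

(** The squared L^2 norm, as a real number split into two real integrals so that the real
    completeness result applies to each part. *)
Definition sqnormC f : R := \int[mu]_x Re (f x) ^+ 2 + \int[mu]_x Im (f x) ^+ 2.

Lemma sqnormC_ge0 f : 0 <= sqnormC f.
Proof. by apply: addr_ge0; apply: Rintegral_ge0 => x _; exact: sqr_ge0. Qed.

Lemma dotC_sqnorm f : L2_C f -> dotC f f = (sqnormC f)%:C.
Proof.
move=> /L2_CP[fr fi]; apply: complex_ext => /=.
- rewrite /sqnormC -RintegralD//; try exact: Lfun2_integrable_sqr.
  by apply: eq_Rintegral => x _; case: (f x) => [? ?] /=; ring.
- transitivity (\int[mu]_(x in setT) (0:R)); last by rewrite Rintegral_cst// mul0r.
  by apply: eq_Rintegral => x _; case: (f x) => [? ?] /=; ring.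
Qed.

Lemma sqnormC_ae f g : L2_C f -> L2_C g ->
  (\forall x \ae mu, f x = g x) -> sqnormC f = sqnormC g.
Proof.
by move=> fL gL fg; apply: complexI; rewrite -!dotC_sqnorm//; exact: dotC_ae.
Qed.

Lemma Rintegral_sqr_eq0 (h : R -> R) : h \in Lfun mu 2%:E ->
  \int[mu]_x h x ^+ 2 = 0 -> \forall x \ae mu, h x = 0.
Proof.
move=> hL int0; have hi := Lfun2_integrable_sqr hL.
have h0 : (\int[mu]_x (h x ^+ 2)%:E = 0)%E by rewrite -EFin_Rintegral// int0.
have : (\int[mu]_x `|(EFin \o (fun x => (h x ^+ 2)%R)) x| = 0)%E.
  by rewrite -h0; apply: eq_integral => x _; rewrite /= ger0_norm// sqr_ge0.
move/(ae_eq_integral_abs mu measurableT (measurable_int mu hi)).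
by apply: filterS => x /(_ I) /= [] /eqP; rewrite sqrf_eq0 => /eqP.
Qed.

Lemma sqnormC_eq0 f : L2_C f -> sqnormC f = 0 -> \forall x \ae mu, f x = 0.
Proof.
move=> /L2_CP[fr fi] /eqP; rewrite paddr_eq0; last 2 first.
- by apply: Rintegral_ge0 => x _; exact: sqr_ge0.
- by apply: Rintegral_ge0 => x _; exact: sqr_ge0.
move=> /andP[/eqP r0 /eqP i0].
apply: filterS2 (Rintegral_sqr_eq0 fr r0) (Rintegral_sqr_eq0 fi i0) => x.
by case: (f x) => a b /= -> ->.
Qed.

Lemma L2_CZ a f : L2_C f -> L2_C (fun x => a * f x).
Proof.
move=> fL; rewrite (_ : (fun x => _) = (fun x => a * f x + 0)).
  exact: L2_C_linear (L2_C0).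
by apply/funext => x; rewrite addr0.
Qed.

Lemma L2_CD f g : L2_C f -> L2_C g -> L2_C (fun x => f x + g x).
Proof.
move=> fL gL; rewrite (_ : (fun x => _) = (fun x => 1 * f x + g x)).
  exact: L2_C_linear.
by apply/funext => x; rewrite mul1r.
Qed.

Lemma L2_CB f g : L2_C f -> L2_C g -> L2_C (fun x => f x - g x).
Proof.
move=> fL gL; rewrite (_ : (fun x => _) = (fun x => -1 * g x + f x)).
  exact: L2_C_linear.
by apply/funext => x; rewrite mulN1r addrC.
Qed.

(** Each of the two real integrals is at most [sqnormC], so real and imaginary parts are Cauchy
    separately; their limits are then recombined. *)
Lemma L2_C_complete (f : nat -> R -> R[i]) : (forall n, L2_C (f n)) ->
  (forall e : R, 0 < e -> exists N : nat, forall m n, (N <= m)%N -> (N <= n)%N ->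
    sqnormC (fun x => f m x - f n x) < e) ->
  exists2 g, L2_C g & (fun n => sqnormC (fun x => f n x - g x)) @ \oo --> (0:R).
Proof.
move=> fL fC.
have ReB (z w : R[i]) : Re (z - w) = Re z - Re w by case: z w => [? ?] [? ?].
have ImB (z w : R[i]) : Im (z - w) = Im z - Im w by case: z w => [? ?] [? ?].
have sqE f1 g1 : sqnormC (fun x => f1 x - g1 x) =
    \int[mu]_x (Re (f1 x) - Re (g1 x)) ^+ 2 + \int[mu]_x (Im (f1 x) - Im (g1 x)) ^+ 2.
  by congr (_ + _); apply: eq_Rintegral => x _; rewrite ?ReB ?ImB.
have [gr grL grC] : exists2 g, g \in Lfun mu 2%:E &
    (fun n => \int[mu]_x (Re (f n x) - g x) ^+ 2) @ \oo --> (0:R).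
  apply: Lfun2_complete => [n|e /fC[N NP]]; first by have /L2_CP[] := fL n.
  exists N => m n Nm Nn; apply: le_lt_trans (NP m n Nm Nn).
  by rewrite sqE lerDl; apply: Rintegral_ge0 => x _; exact: sqr_ge0.
have [gi giL giC] : exists2 g, g \in Lfun mu 2%:E &
    (fun n => \int[mu]_x (Im (f n x) - g x) ^+ 2) @ \oo --> (0:R).
  apply: Lfun2_complete => [n|e /fC[N NP]]; first by have /L2_CP[] := fL n.
  exists N => m n Nm Nn; apply: le_lt_trans (NP m n Nm Nn).
  by rewrite sqE lerDr; apply: Rintegral_ge0 => x _; exact: sqr_ge0.
exists (fun x => gr x +i* gi x); first exact/L2_CP.
rewrite -(addr0 0); rewrite (_ : (fun n => sqnormC _) =
    (fun n => \int[mu]_x (Re (f n x) - gr x) ^+ 2) +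
    (fun n => \int[mu]_x (Im (f n x) - gi x) ^+ 2)); first exact: cvgD.
by apply/funext => n; rewrite sqE.
Qed.

End ComplexIntegral.

(** * Idempotent components of classes, and the bicomplex Hilbert space *)

Section BicomplexL2.
Context {R : realType}.
Local Notation mu := (@lebesgue_measure R).
Implicit Types (u v w : L2 R) (a : bicomplex R).

#[local] Existing Instance lebesgue_ae_filter.

(** [integral_T] integrates z1 and z2 of z1 + z2 i2, whereas the inner product is computed in
    idempotent coordinates. Since z1 = (P1 + P2)/2 and z2 = i1 (P1 - P2)/2 have constant
    coefficients, linearity of the integral carries one form into the other. *)
Lemma integral_T_components (F : R -> bicomplex R) :
  integrable_C (fun x => P1 (F x)) -> integrable_C (fun x => P2 (F x)) ->
  P1 (integral_T F) = integral_C (fun x => P1 (F x)) /\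
  P2 (integral_T F) = integral_C (fun x => P2 (F x)).
Proof.
move=> i1 i2.
have ReE : (fun x => Re (F x)) = (fun x => (2^-1)%:C * P1 (F x) + (2^-1)%:C * P2 (F x)).
  apply/funext => x; rewrite /P1 /P2; case: (F x) => [[p q] [r s]].
  by apply: complex_ext => /=; field.
have ImE : (fun x => Im (F x)) =
    (fun x => (0 +i* 2^-1) * P1 (F x) + (0 +i* - 2^-1) * P2 (F x)).
  apply/funext => x; rewrite /P1 /P2; case: (F x) => [[p q] [r s]].
  by apply: complex_ext => /=; field.
have intE b c : integral_C (fun x => b * P1 (F x) + c * P2 (F x)) =
    b * integral_C (fun x => P1 (F x)) + c * integral_C (fun x => P2 (F x)).
  by rewrite integral_CD ?integral_CZ//; exact: integrable_CZ.
rewrite /integral_T ReE ImE !intE.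
case: (integral_C (P1 \o F)) (integral_C (P2 \o F)) => [p q] [r s].
by split; apply: complex_ext => /=; field.
Qed.

(** Components of the representative picked by [repr]. This choice does not commute with the module
    operations, so the rules for [comp1] and [comp2] below hold only almost everywhere. *)
Definition comp1 u (x : R) : R[i] := P1 ((repr u : L2fun) x).
Definition comp2 u (x : R) : R[i] := P2 ((repr u : L2fun) x).

Lemma L2_comp1 u : L2_C (comp1 u).
Proof. by rewrite /comp1; case: (repr u) => f /= /asboolP[]. Qed.

Lemma L2_comp2 u : L2_C (comp2 u).
Proof. by rewrite /comp2; case: (repr u) => f /= /asboolP[]. Qed.

Lemma reprD u v : \forall x \ae mu,
  (repr (u + v) : L2fun) x = (repr u : L2fun) x + (repr v : L2fun) x.
Proof.
have := reprL2_ae (repr u + repr v); apply: filterS => x /(_ I).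
by rewrite L2fun_valD.
Qed.

Lemma reprZ a u : \forall x \ae mu,
  (repr (a *: u) : L2fun) x = a * (repr u : L2fun) x.
Proof. by have := reprL2_ae (a *: repr u); apply: filterS => x /(_ I). Qed.

Lemma reprB u v : \forall x \ae mu,
  (repr (u - v) : L2fun) x = (repr u : L2fun) x - (repr v : L2fun) x.
Proof.
apply: filterS2 (reprD u (- v)) (reprL2_ae (- repr v)) => x -> /(_ I) e.
by rewrite L2fun_valN in e; congr (_ + _); exact: e.
Qed.

Lemma L2_ip_components u v : P1 (L2_ip u v) = dotC (comp1 u) (comp1 v) /\
  P2 (L2_ip u v) = dotC (comp2 u) (comp2 v).
Proof.
have F1 : (fun x => P1 (dagger3 ((repr u : L2fun) x) * (repr v : L2fun) x)) =
    (fun x => conjc (comp1 u x) * comp1 v x).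
  by apply/funext => x; rewrite dagger3_mulE !PE mul0r addr0 mul1r.
have F2 : (fun x => P2 (dagger3 ((repr u : L2fun) x) * (repr v : L2fun) x)) =
    (fun x => conjc (comp2 u x) * comp2 v x).
  by apply/funext => x; rewrite dagger3_mulE !PE mul0r add0r mul1r.
rewrite /dotC -F1 -F2; apply: integral_T_components.
- by rewrite F1; apply: L2_C_mul; exact: L2_comp1.
- by rewrite F2; apply: L2_C_mul; exact: L2_comp2.
Qed.

Lemma L2_eq u v : (\forall x \ae mu, comp1 u x = comp1 v x) ->
  (\forall x \ae mu, comp2 u x = comp2 v x) -> u = v.
Proof.
move=> h1 h2; rewrite -[u]reprK -[v]reprK; apply/pi_L2P.
by apply: filterS2 h1 h2 => x e1 e2 _; exact: bicomplex_eq.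
Qed.

Lemma comp1D u v : \forall x \ae mu, comp1 (u + v) x = comp1 u x + comp1 v x.
Proof. by apply: filterS (reprD u v) => x; rewrite /comp1 => ->; rewrite P1D. Qed.
Lemma comp2D u v : \forall x \ae mu, comp2 (u + v) x = comp2 u x + comp2 v x.
Proof. by apply: filterS (reprD u v) => x; rewrite /comp2 => ->; rewrite P2D. Qed.
Lemma comp1B u v : \forall x \ae mu, comp1 (u - v) x = comp1 u x - comp1 v x.
Proof.
by apply: filterS (reprB u v) => x; rewrite /comp1 => ->; rewrite P1D P1N.
Qed.
Lemma comp2B u v : \forall x \ae mu, comp2 (u - v) x = comp2 u x - comp2 v x.
Proof.
by apply: filterS (reprB u v) => x; rewrite /comp2 => ->; rewrite P2D P2N.
Qed.
Lemma comp1Z a u : \forall x \ae mu, comp1 (a *: u) x = P1 a * comp1 u x.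
Proof. by apply: filterS (reprZ a u) => x; rewrite /comp1 => ->; rewrite P1M. Qed.
Lemma comp2Z a u : \forall x \ae mu, comp2 (a *: u) x = P2 a * comp2 u x.
Proof. by apply: filterS (reprZ a u) => x; rewrite /comp2 => ->; rewrite P2M. Qed.

Lemma P1_L2_ip u v : P1 (L2_ip u v) = dotC (comp1 u) (comp1 v).
Proof. by have [] := L2_ip_components u v. Qed.
Lemma P2_L2_ip u v : P2 (L2_ip u v) = dotC (comp2 u) (comp2 v).
Proof. by have [] := L2_ip_components u v. Qed.

Lemma P1_dagger3 a : P1 (dagger3 a) = conjc (P1 a).
Proof. by rewrite /dagger3 !PE. Qed.
Lemma P2_dagger3 a : P2 (dagger3 a) = conjc (P2 a).
Proof. by rewrite /dagger3 !PE. Qed.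

Lemma L2_scalar_product : bicomplex_scalar_product (M := L2 R) (@L2_ip R).
Proof.
have ae_refl (f : R -> R[i]) : \forall x \ae mu, f x = f x by exact: nearW.
have L1 := L2_comp1; have L2' := L2_comp2.
split=> [u v w|a u v|u v|u|u].
- apply: bicomplex_eq; rewrite ?P1D ?P2D ?P1_L2_ip ?P2_L2_ip -dotCD//.
  + by apply: dotC_ae (comp1D v w) => //; exact: L2_CD.
  + by apply: dotC_ae (comp2D v w) => //; exact: L2_CD.
- apply: bicomplex_eq; rewrite ?P1M ?P2M ?P1_L2_ip ?P2_L2_ip -dotCZ//.
  + by apply: dotC_ae (comp1Z a v) => //; exact: L2_CZ.
  + by apply: dotC_ae (comp2Z a v) => //; exact: L2_CZ.
- apply: bicomplex_eq.
  + by rewrite [RHS]P1_dagger3 [LHS]P1_L2_ip P1_L2_ip; exact: dotC_conj.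
  + by rewrite [RHS]P2_dagger3 [LHS]P2_L2_ip P2_L2_ip; exact: dotC_conj.
- split=> [u0|->].
  + have sq1 : sqnormC (comp1 u) = 0.
      by apply: complexI; rewrite -dotC_sqnorm// -P1_L2_ip u0 P1_0.
    have sq2 : sqnormC (comp2 u) = 0.
      by apply: complexI; rewrite -dotC_sqnorm// -P2_L2_ip u0 P2_0.
    (* Writing 0 as [u - u] gives access to its components through [comp1B] and [comp2B]. *)
    rewrite -(subrr u); apply: L2_eq.
    * apply: filterS2 (comp1B u u) (sqnormC_eq0 (L1 u) sq1) => x -> ->.
      by rewrite subrr.
    * apply: filterS2 (comp2B u u) (sqnormC_eq0 (L2' u) sq2) => x -> ->.
      by rewrite subrr.
  (* The representative of 0 need not be the zero function. Reading 0 as [0 *: 0] shows that its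
     components are almost everywhere 0 times themselves, and [dotCZ] extracts this factor. *)
  + have c1 := comp1Z 0 (0 : L2 R); have c2 := comp2Z 0 (0 : L2 R).
    rewrite scale0r in c1 c2.
    apply: bicomplex_eq; [rewrite P1_L2_ip P1_0|rewrite P2_L2_ip P2_0].
    * rewrite (dotC_ae _ _ _ _ (ae_refl _) c1) ?dotCZ ?P1_0 ?mul0r//.
      exact: L2_CZ.
    * rewrite (dotC_ae _ _ _ _ (ae_refl _) c2) ?dotCZ ?P2_0 ?mul0r//.
      exact: L2_CZ.
- exists (sqnormC (comp1 u)), (sqnormC (comp2 u)); split; try exact: sqnormC_ge0.
  by rewrite -!dotC_sqnorm// -P1_L2_ip -P2_L2_ip; exact: idempotentE.
Qed.

(** Scaling by [e1] keeps the first component almost everywhere, as [P1 e1 = 1], and likewise for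
    [e2] and the second. The norm thus becomes an expression in real integrals. *)
Lemma Tnorm_L2 u : Tnorm (@L2_ip R) u =
  (Num.sqrt 2)^-1 * Num.sqrt (sqnormC (comp1 u) + sqnormC (comp2 u)).
Proof.
rewrite /Tnorm P1_L2_ip P2_L2_ip; congr (_ * Num.sqrt _).
have -> : dotC (comp1 (e1 *: u)) (comp1 (e1 *: u)) = (sqnormC (comp1 u))%:C.
  rewrite -dotC_sqnorm; last exact: L2_comp1.
  have h : \forall x \ae mu, comp1 (e1 *: u) x = comp1 u x.
    by apply: filterS (comp1Z e1 u) => x ->; rewrite P1e1 mul1r.
  by apply: dotC_ae => //; exact: L2_comp1.
have -> : dotC (comp2 (e2 *: u)) (comp2 (e2 *: u)) = (sqnormC (comp2 u))%:C.
  rewrite -dotC_sqnorm; last exact: L2_comp2.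
  have h : \forall x \ae mu, comp2 (e2 *: u) x = comp2 u x.
    by apply: filterS (comp2Z e2 u) => x ->; rewrite P2e2 mul1r.
  by apply: dotC_ae => //; exact: L2_comp2.
by [].
Qed.

Lemma L2_complete : Tcomplete (M := L2 R) (@L2_ip R).
Proof.
move=> u uC.
have sqB1 v w : sqnormC (comp1 (v - w)) = sqnormC (fun x => comp1 v x - comp1 w x).
  by apply: sqnormC_ae (comp1B v w); [exact: L2_comp1|apply: L2_CB; exact: L2_comp1].
have sqB2 v w : sqnormC (comp2 (v - w)) = sqnormC (fun x => comp2 v x - comp2 w x).
  by apply: sqnormC_ae (comp2B v w); [exact: L2_comp2|apply: L2_CB; exact: L2_comp2].
have C12 (e : R) : 0 < e -> exists N : nat, forall m n, (N <= m)%N -> (N <= n)%N ->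
    sqnormC (comp1 (u m - u n)) + sqnormC (comp2 (u m - u n)) < e.
  move=> e0; have s2 : 0 < Num.sqrt 2 :> R by rewrite sqrtr_gt0.
  (* This threshold is the value of the norm formula when the two squared norms add up to [e];
     strict monotonicity of the square root recovers the bound [e]. *)
  have [N NP] := uC ((Num.sqrt 2)^-1 * Num.sqrt e)
    (ltac:(by rewrite mulr_gt0 ?invr_gt0// sqrtr_gt0)).
  exists N => m n Nm Nn; have := NP m n Nm Nn.
  by rewrite Tnorm_L2 ltr_pM2l ?invr_gt0// ltr_sqrt.
have [g1 g1L g1C] : exists2 g, L2_C g &
    (fun n => sqnormC (fun x => comp1 (u n) x - g x)) @ \oo --> (0:R).
  apply: L2_C_complete => [n|e /C12[N NP]]; first exact: L2_comp1.
  exists N => m n Nm Nn; apply: le_lt_trans (NP m n Nm Nn).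
  by rewrite sqB1 lerDl sqnormC_ge0.
have [g2 g2L g2C] : exists2 g, L2_C g &
    (fun n => sqnormC (fun x => comp2 (u n) x - g x)) @ \oo --> (0:R).
  apply: L2_C_complete => [n|e /C12[N NP]]; first exact: L2_comp2.
  exists N => m n Nm Nn; apply: le_lt_trans (NP m n Nm Nn).
  by rewrite -sqB2 lerDr sqnormC_ge0.
(* The limit is assembled pointwise from the two component limits, then passed to its class; the
   representative of that class agrees with [G] only almost everywhere. *)
pose G : R -> (bicomplex R)^o := fun x => (g1 x)%:BC * e1 + (g2 x)%:BC * e2.
have G1 : (fun x => P1 (G x)) = g1 by apply/funext => x; rewrite /G !PE.
have G2 : (fun x => P2 (G x)) = g2 by apply/funext => x; rewrite /G !PE.
have GL : G \in L2_T by apply/asboolP; rewrite G1 G2.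
pose l : L2 R := \pi_(L2 R)%qT (MkL2fun GL).
have l1 : \forall x \ae mu, comp1 l x = g1 x.
  by apply: filterS (reprL2_ae (MkL2fun GL)) => x /(_ I); rewrite /comp1 -G1 => ->.
have l2 : \forall x \ae mu, comp2 l x = g2 x.
  by apply: filterS (reprL2_ae (MkL2fun GL)) => x /(_ I); rewrite /comp2 -G2 => ->.
exists l; rewrite /Tcvg_to.
rewrite (_ : (fun n => _) = (fun n => (Num.sqrt 2)^-1 * Num.sqrt
    (sqnormC (fun x => comp1 (u n) x - g1 x) +
     sqnormC (fun x => comp2 (u n) x - g2 x)))).
  (* The limit 0 is rewritten as the norm formula at 0, so that continuity of the square root
     reduces the claim to the two squared norms. *)
  rewrite -(mulr0 (Num.sqrt 2)^-1) -sqrtr0; apply: cvgMr.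
  apply: continuous_cvg; first exact: sqrt_continuous.
  by rewrite -(addr0 0); exact: cvgD.
apply/funext => n; rewrite Tnorm_L2; congr (_ * Num.sqrt (_ + _)).
- rewrite sqB1; apply: sqnormC_ae; try by apply: L2_CB => //; exact: L2_comp1.
  by apply: filterS l1 => x ->.
- rewrite sqB2; apply: sqnormC_ae; try by apply: L2_CB => //; exact: L2_comp2.
  by apply: filterS l2 => x ->.
Qed.

End BicomplexL2.

Theorem corollary4p1 (R : realType) :
  bicomplex_hilbert_space (M := L2 R) (@L2_ip R).
Proof. by split; [exact: L2_scalar_product|exact: L2_complete]. Qed.
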